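(* Let $X$ be a separable Banach space with topological dual $X'$ and let $g:[-1,1]^{\mathbb N}\to X$. Let $p\in(0,1)$ and $k:=\lceil\frac{1}{1-p}\rceil$. Suppose that: (1) for a.e. $\boldsymbol y\in[-1,1]^{\mathbb N}$, $\|g(\boldsymbol y)-g_s(\boldsymbol y)\|_X\to0$ as $s\to\infty$; (2) there are a sequence $(\Theta_m)_{m\ge0}$ of nonnegative numbers and a sequence $\boldsymbol b=(b_j)_{j\ge1}\in\ell^p(\mathbb N)$ with $b_1\ge b_2\ge\cdots\ge0$ such that $g$ is continuously differentiable up to order $k+1$, with $$\|\partial^{\boldsymbol\nu}g(\boldsymbol y)\|_X\le\Theta_{|\boldsymbol\nu|}\,\boldsymbol b^{\boldsymbol\nu}$$ for all $\boldsymbol y\in[-1,1]^{\mathbb N}$ and all $\boldsymbol\nu\in\mathcal F_k:=\{\boldsymbol\nu\in\mathbb N_0^{\mathbb N}:|\boldsymbol\nu|\le k+1\}$. Then there exists a constant $C>0$, independent of the dimension $s$, such that for all $s\in\mathbb N$ $$\bigg\|\int_{[-1,1]^{\mathbb N}}(g(\boldsymbol y)-g_s(\boldsymbol y))\,\boldsymbol\gamma({\rm d}\boldsymbol y)\bigg\|_X\le Cs^{-\frac2p+1},$$ and, with the same constant $C$, for every $G\in X'$ and all $s\in\mathbb N$ $$\bigg|\int_{[-1,1]^{\mathbb N}}G(g(\boldsymbol y)-g_s(\boldsymbol y))\,\boldsymbol\gamma({\rm d}\boldsymbol y)\bigg|\le C\|G\|_{X'}s^{-\frac2p+1}.$$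
   Context: $\mathbb N=\{1,2,\dots\}$, $\mathbb N_0=\mathbb N\cup\{0\}$. For a function $g$ on $[-1,1]^{\mathbb N}$ and $s\in\mathbb N$, $g_s(\boldsymbol y):=g(\boldsymbol y_{\le s},\mathbf 0):=g(y_1,\dots,y_s,0,0,\dots)$. $\boldsymbol\gamma({\rm d}\boldsymbol y):=\bigotimes_{j\ge1}\frac{{\rm d}y_j}{2}$ is the uniform (product) probability measure on $[-1,1]^{\mathbb N}$; ''a.e.'' refers to $\boldsymbol\gamma$, and integrals of $X$-valued functions are Bochner integrals. For a multi-index $\boldsymbol\nu\in\mathbb N_0^{\mathbb N}$ with finite support, $|\boldsymbol\nu|:=\sum_{j\ge1}\nu_j$, $\boldsymbol b^{\boldsymbol\nu}:=\prod_{j\ge1}b_j^{\nu_j}$ with the convention $0^0:=1$, and $\partial^{\boldsymbol\nu}$ denotes the corresponding mixed partial derivative with respect to the variables $y_j$. *)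

(* Defs.v *)
From HB Require Import structures.
From mathcomp Require Import all_boot all_order all_algebra finmap.
From mathcomp Require Import all_classical all_reals all_analysis.

Set Implicit Arguments.
Unset Strict Implicit.
Unset Printing Implicit Defensive.

Import Order.TTheory GRing.Theory Num.Theory.
Import numFieldNormedType.Exports.

Local Open Scope classical_set_scope.
Local Open Scope ring_scope.

(* The variables y_1, y_2, ... are indexed by nat from 0, so y_j is y (j - 1)
   and y_1, ..., y_s are the y i with i < s. Functions on [-1,1]^N are functions
   on nat -> R of which only the values on [cube] matter. *)

Section parametric_domain.
Variable R : realType.

Definition cube : set (nat -> R) := [set y | forall j, y j \in `[-1, 1] ].

Definition truncate (s : nat) (y : nat -> R) : nat -> R :=
  fun j => if (j < s)%N then y j else 0.

Definition coordinate_sets : set (set (nat -> R)) :=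
  \bigcup_j preimage_set_system setT (fun y : nat -> R => y j)
              (measurable : set (set (measurableTypeR R))).

Lemma ltrN1_1 : -1 < 1 :> R.
Proof. exact: lt_trans (ltrN10 R) ltr01. Qed.

(* By Dynkin's lemma at most one probability measure on the product
   sigma-algebra has this property: the product of the measures dy_j / 2. *)
Definition is_uniform_product
    (gamma : probability (g_sigma_algebraType coordinate_sets) R) : Prop :=
  forall (n : nat) (B : nat -> set (measurableTypeR R)),
    (forall j, measurable (B j)) ->
    gamma [set y | forall j, (j < n)%N -> B j (y j)] =
    (\prod_(j < n) uniform_prob ltrN1_1 (B j))%E.

End parametric_domain.

Arguments coordinate_sets : clear implicits.
Arguments cube {R} _.

Section partial_derivatives.
Variables (R : realType) (X : normedModType R).
Implicit Types f : (nat -> R) -> X.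

(* The increment t - y j is restricted to t in [-1,1]: at the end points of
   [-1,1] the derivative is one-sided. *)
Definition difference_quotient (j : nat) f (y : nat -> R) (t : R) : X :=
  (t - y j)^-1 *: (f [eta y with j |-> t] - f y).

Definition has_partial (j : nat) f (y : nat -> R) : Prop :=
  cvg (difference_quotient j f y @ within `[-1, 1] (y j)^').

Definition partial (j : nat) f : (nat -> R) -> X :=
  fun y => lim (difference_quotient j f y @ within `[-1, 1] (y j)^').

Definition partials (l : seq nat) f : (nat -> R) -> X := foldr partial f l.

Definition splice (n : nat) (v : 'rV[R]_n) (y : nat -> R) : nat -> R :=
  fun j => if insub j is Some i then v ord0 i else y j.

(* Joint continuity in any finitely many of the variables, the others being
   fixed. This is weaker than continuity for the product topology or the
   sup-norm topology of [-1,1]^N. *)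
Definition continuous_on_sections f : Prop :=
  forall (n : nat) (y : nat -> R), cube y ->
    {within [set v : 'rV[R]_n | forall i, v ord0 i \in `[-1, 1] ],
      continuous (fun v => f (splice v y))}.

Definition continuously_differentiable (m : nat) f : Prop :=
  (forall (l : seq nat) (j : nat) (y : nat -> R),
     (size l < m)%N -> cube y -> has_partial j (partials l f) y) /\
  (forall l : seq nat, (size l <= m)%N -> continuous_on_sections (partials l f)).

End partial_derivatives.

Definition multi_index := {fsfun nat -> nat with 0%N}.

Definition multi_order (nu : multi_index) : nat := (\sum_(j <- finsupp nu) nu j)%N.

Definition multi_power (R : realType) (b : nat -> R) (nu : multi_index) : R :=
  \prod_(j <- finsupp nu) b j ^+ nu j.

Definition mixed_partial (R : realType) (X : normedModType R)
    (nu : multi_index) (f : (nat -> R) -> X) : (nat -> R) -> X :=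
  partials (flatten [seq nseq (nu j) j | j <- sort leq (finsupp nu)]) f.

Definition separable_space (T : topologicalType) : Prop :=
  exists2 S : set T, countable S & dense S.

Definition dual_norm (R : realType) (X : normedModType R) (G : X -> R) : R :=
  sup [set `|G x| | x in [set x : X | `|x| <= 1]].

Section bochner.
Context d (T : measurableType d) (R : realType) (X : normedModType R).
Variables (mu : {finite_measure set T -> \bar R}) (D : set T).

Definition bochner_simple (phi : T -> X) : Prop :=
  finite_set (range phi) /\
  forall x : X, measurable (D `&` phi @^-1` [set x]).

Definition simple_integral (phi : T -> X) : X :=
  \sum_(x \in range phi) fine (mu (D `&` phi @^-1` [set x])) *: x.

(* Strong measurability of f on D is the almost everywhere convergence. *)
Definition bochner_approx (f : T -> X) (phi : nat -> T -> X) : Prop :=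
  [/\ forall n, bochner_simple (phi n),
      {ae mu, forall t, D t -> phi n t @[n --> \oo] --> f t} &
      (\int[mu]_(t in D) `|f t - phi n t|%:E)%E @[n --> \oo] --> 0%E].

Definition bochner_integrable (f : T -> X) : Prop :=
  exists phi : nat -> T -> X, bochner_approx f phi.

(* The limit does not depend on phi; the value is 0 when f is not integrable. *)
Definition bochner_integral (f : T -> X) : X :=
  xget 0 [set I | exists2 phi : nat -> T -> X, bochner_approx f phi &
                    simple_integral (phi n) @[n --> \oo] --> I].

End bochner.

(* Main.v *)
Require Import Defs.
From HB Require Import structures.
From mathcomp Require Import all_boot all_order all_algebra finmap.
From mathcomp Require Import all_classical all_reals all_analysis.
From mathcomp Require Import measurable_realfun ring lra.

Set Implicit Arguments.
Unset Strict Implicit.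
Unset Printing Implicit Defensive.

Import Order.TTheory GRing.Theory Num.Theory.
Import numFieldNormedType.Exports.

Local Open Scope classical_set_scope.
Local Open Scope ring_scope.

(** The truncation error is a sum of second differences, one per discarded
    coordinate.  Let [g_m] be [g] with every coordinate but the first [m] set
    to 0, and write [g_n - g_s] as the sum of [g_(m+1) - g_m] over
    [s <= m < n].  The [m]-th increment only moves coordinate [m] from 0 to its
    value [t], and the law of [t] is symmetric: in the mean the increment may be
    replaced by half of [h t + h (- t) - 2 h 0], where [h] is [g] as a function
    of that coordinate.  The first order terms cancel and what remains is at
    most [Theta 2 * b m ^+ 2] ([second_difference_bound]).  Hence the mean of
    [g_n - g_s] is at most [Theta 2] times the sum of the [b m ^+ 2] with
    [m >= s], uniformly in [n].  As [b] is nonincreasing and in l^p with sum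
    [S] of [p]-th powers, [b m `^ p <= S / m.+1], and that tail is of order
    [s `^ (1 - 2 / p)] ([lp_square_tail]).

    The cancellation is used for averages over a finite grid that is symmetric
    in each coordinate ([grid_sum_truncation]), where it is a reindexing of a
    finite sum by the reflection of one coordinate.  Grid averages become
    integrals as follows.  At level [n], the function [f := g - g_s] is replaced
    by its value at the grid point obtained by rounding the first [n]
    coordinates and setting the others to 0.  This is a simple function, the
    product cells on which it is constant all have the same mass, and so its
    integral is a grid average ([norm_grid_simple_integral]).  The bounds
    [Theta 1 * b j] on the first derivatives, which are summable, make
    both operations cost little, with a bound that is the same
    at every point where [g_m] tends to [g] ([grid_rounding_dist]): the simple
    functions tend to [f] uniformly off a null set.

    The function [f] is only almost everywhere equal to a measurable one, so
    the integral of [`|f - psi|] is a lower integral, which is monotone but not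
    additive.  A uniform approximation off a null set allows one to argue by
    monotonicity alone: a function with finitely many values below
    [`|f - psi|] controls the distance between the simple integrals of [psi]
    and of the grid approximations ([simple_integral_dist]).  Every limit of
    simple integrals that can serve as the Bochner integral of [f] thus inherits
    the bound on the grid averages.  For a functional [G] the same comparison is
    made with the positive and the negative part of [G \o f]
    ([abs_integral_functional_le]). *)

(** * Mean value inequality and second differences of vector-valued functions *)

Section mean_value.
Variables (R : realType) (X : normedModType R).
Implicit Types (phi dphi : R -> X) (A : set R).

Lemma local_growth_bound A phi (c : R) (dphi_c : X) (K : R) :
  (t - c)^-1 *: (phi t - phi c) @[t --> within A c^'] --> dphi_c ->
  `|dphi_c| < K ->
  exists2 d : R, 0 < d &
    forall t, A t -> `|t - c| < d -> `|phi t - phi c| <= K * `|t - c|.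
Proof.
move=> phic dphiK.
have e0 : 0 < K - `|dphi_c| by rewrite subr_gt0.
move/cvgrPdist_le : phic => /(_ _ e0).
move=> /nbhs_ballP[d /= d0 dP].
exists d => // t At tcd.
have [->|tc] := eqVneq t c; first by rewrite !subrr !normr0 mulr0.
have := dP t; rewrite /ball/= distrC => /(_ tcd tc At) H.
have tc0 : t - c != 0 by rewrite subr_eq0.
rewrite -[phi t - phi c]scale1r -(divff tc0) -scalerA normrZ mulrC.
rewrite ler_wpM2r//; set q := (_ *: _) in H *.
have -> : q = dphi_c - (dphi_c - q) by rewrite opprB addrC subrK.
rewrite (le_trans (ler_normB _ _))//; lra.
Qed.

(** There is no mean value equality for functions with values in [X]; a
    supremum argument replaces it. For every [L > K], the set of points up to
    which the increment of [phi] is at most [L] times the length contains its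
    supremum, and by [local_growth_bound] this supremum is [b]. One-sided
    derivatives at the end points are covered, since the limits are taken
    within [A]. *)
Lemma mean_value_ineq A phi dphi (K a b : R) : a <= b ->
  (forall c, a <= c <= b -> A c) ->
  (forall c, a <= c <= b ->
     (t - c)^-1 *: (phi t - phi c) @[t --> within A c^'] --> dphi c) ->
  (forall c, a <= c <= b -> `|dphi c| <= K) ->
  `|phi b - phi a| <= K * (b - a).
Proof.
move=> ab abA phid dK; apply/ler_addgt0Pr => e e0.
(* Adding 1 keeps the denominator positive when [a = b]. *)
set L := K + e / (b - a + 1).
have ba1 : 0 < b - a + 1 by lra.
have KL : K < L by rewrite ltrDl divr_gt0.
suff H : `|phi b - phi a| <= L * (b - a).
  rewrite (le_trans H)// /L mulrDl lerD2l -mulrA ler_piMr// ?(ltW e0)//.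
  by rewrite mulrC ler_pdivrMr//; lra.
pose S := [set x | a <= x <= b /\ `|phi x - phi a| <= L * (x - a)].
have Sa : S a by split; rewrite ?lexx// !subrr normr0 mulr0.
have Sub : ubound S b by move=> x [/andP[]].
have hS : has_sup S by split; [exists a | exists b].
pose c := sup S.
have leSc x : S x -> x <= c by exact: sup_upper_bound hS x.
have ac : a <= c by exact: leSc.
have cb : c <= b by apply: ge_sup => //; exists a.
have acb : a <= c <= b by rewrite ac.
have [d d0 dP] := local_growth_bound (phid c acb) (le_lt_trans (dK c acb) KL).
have Sc : `|phi c - phi a| <= L * (c - a).
  have [x Sx xc] := sup_adherent d0 hS.
  have xlec := leSc x Sx.
  case: Sx => axb phix; rewrite -/c in xc.
  have := dP x (abA _ axb); rewrite ler0_norm; last lra.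
  rewrite opprB distrC => dPx.
  have {}dPx := dPx ltac:(lra).
  have -> : phi c - phi a = (phi c - phi x) + (phi x - phi a).
    by rewrite addrA subrK.
  rewrite (le_trans (ler_normD _ _))// (le_trans (lerD dPx phix))//; lra.
have [->//|cnb] := eqVneq b c.
have cltb : c < b by rewrite lt_neqAle eq_sym cnb.
pose v := Num.min b (c + d / 2).
have cv : c < v by rewrite lt_min cltb; lra.
have vd : v <= c + d / 2 by rewrite ge_min lexx orbT.
have vb : v <= b by rewrite ge_min lexx.
have avb : a <= v <= b by rewrite vb andbT; lra.
suff Sv : S v by have := leSc v Sv; lra.
split=> //.
have := dP v (abA _ avb); rewrite gtr0_norm; last lra.
move=> /(_ ltac:(lra)) dPv.
have -> : phi v - phi a = (phi v - phi c) + (phi c - phi a).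
  by rewrite addrA subrK.
rewrite (le_trans (ler_normD _ _))// (le_trans (lerD dPv Sc))//; lra.
Qed.

End mean_value.

Section one_variable.
Variables (R : realType) (X : normedModType R).
Implicit Types h : R -> X.

Definition derivative_on (h h' : R -> X) := forall c : R, c \in `[-1, 1] ->
  (t - c)^-1 *: (h t - h c) @[t --> within `[-1, 1] c^'] --> h' c.

Lemma lipschitz_of_derivative_bound h (h' : R -> X) (K : R) :
  derivative_on h h' ->
  (forall c : R, c \in `[-1, 1] -> `|h' c| <= K) ->
  forall a b : R, a \in `[-1, 1] -> b \in `[-1, 1] ->
  `|h b - h a| <= K * `|b - a|.
Proof.
move=> hd hK a b; wlog ab : a b / a <= b => [H|].
  have [ab|ba] := leP a b; first exact: H.
  by move=> aI bI; rewrite distrC (distrC b); apply: H => //; exact: ltW.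
rewrite !in_itv/= => aI bI; rewrite [X in _ * X]ger0_norm ?subr_ge0//.
have I c : a <= c <= b -> c \in `[-1, 1] by rewrite in_itv/=; lra.
apply: (@mean_value_ineq _ _ `[-1, 1] _ h') => //.
- by move=> c /I cI; exact: hd.
- by move=> c /I; exact: hK.
Qed.

(** Mean value inequality for [h s - s *: h' 0], whose derivative [h' c - h' 0]
    is at most [K] by the same inequality for [h']. *)
Lemma first_order_taylor h (h' h'' : R -> X) (K : R) :
  derivative_on h h' -> derivative_on h' h'' ->
  (forall c : R, c \in `[-1, 1] -> `|h'' c| <= K) ->
  forall t : R, t \in `[-1, 1] -> `|h t - h 0 - t *: h' 0| <= K.
Proof.
move=> hd h'd hK t tI.
have I0 : 0 \in `[-1, 1 : R] by rewrite in_itv/=; lra.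
have K0 : 0 <= K by rewrite (le_trans _ (hK 0 I0)).
pose u := fun s => h s - s *: h' 0.
have ud : derivative_on u (fun c => h' c - h' 0).
  move=> c cI.
  have H : (t - c)^-1 *: (h t - h c) - h' 0 @[t --> within `[-1, 1] c^']
           --> h' c - h' 0.
    by apply: cvgB; [exact: hd | exact: cvg_cst].
  apply: cvg_trans H; apply: near_eq_cvg.
  near=> s.
  have sc : s - c != 0.
    rewrite subr_eq0; near: s; rewrite near_withinE.
    by apply: filterS (nbhs_dnbhs_neq c).
  have -> : u s - u c = (h s - h c) - (s - c) *: h' 0.
    rewrite /u scalerBl !opprB (addrC (c *: _)) addrACA.
    by rewrite (addrC (- _) (c *: _)).
  by rewrite [RHS]scalerBr scalerA mulVf// scale1r.
have uK c : c \in `[-1, 1] -> `|h' c - h' 0| <= K.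
  move=> cI; rewrite (le_trans (lipschitz_of_derivative_bound h'd hK I0 cI))//.
  by rewrite subr0 ler_piMr// ler_norml; move: cI; rewrite in_itv.
have := lipschitz_of_derivative_bound ud uK I0 tI.
rewrite /u scale0r !subr0 addrAC => /le_trans; apply.
by rewrite ler_piMr// ler_norml; move: tI; rewrite in_itv.
Unshelve. all: by end_near. Qed.

(** The first order terms [t *: h' 0] and [- t *: h' 0] of the two Taylor
    expansions cancel. *)
Lemma second_difference_bound h (h' h'' : R -> X) (K : R) :
  derivative_on h h' -> derivative_on h' h'' ->
  (forall c : R, c \in `[-1, 1] -> `|h'' c| <= K) ->
  forall t : R, t \in `[-1, 1] -> `|h t + h (- t) - h 0 *+ 2| <= K *+ 2.
Proof.
move=> hd h'd hK t tI.
have ntI : - t \in `[-1, 1] by move: tI; rewrite !in_itv/=; lra.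
have -> : h t + h (- t) - h 0 *+ 2 =
  (h t - h 0 - t *: h' 0) + (h (- t) - h 0 - (- t) *: h' 0).
  by rewrite scaleNr opprK mulr2n opprD addrACA [RHS]addrACA addNr addr0.
rewrite mulr2n (le_trans (ler_normD _ _))// lerD//;
exact: first_order_taylor hd h'd hK _ _.
Qed.

End one_variable.

(** * Lower integrals and functions constant on finitely many cells *)

Section lower_integral.
Import HBNNSimple.
Context d (T : measurableType d) (R : realType).
Variables (mu : {measure set T -> \bar R}) (D : set T).
Local Open Scope ereal_scope.

(** The integral of an arbitrary nonnegative function is the supremum of the
    integrals of the simple functions below it. Cutting such a simple function
    off on a null set does not change its integral, hence monotonicity up to a
    null set even for functions that are not measurable. *)
Lemma ge0_ae_le_integral_lower (F F' : T -> \bar R) :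
  (forall t, D t -> 0 <= F t) -> (forall t, D t -> 0 <= F' t) ->
  {ae mu, forall t, D t -> F t <= F' t} ->
  \int[mu]_(t in D) F t <= \int[mu]_(t in D) F' t.
Proof.
move=> F0 F'0 [N [mN muN FF']]; rewrite !ge0_integralE//.
apply: ge_ereal_sup => _ [h /= hF <-].
have mNc : measurable (~` N) by exact: measurableC.
have -> : sintegral mu h = sintegral mu (proj_nnsfun h mNc).
  rewrite -!integralT_nnsfun; apply: ae_eq_integral => //.
  - by apply/measurable_EFinP.
  - by apply/measurable_EFinP.
  - exists N; split => // t /= tN; apply: contrapT => Nt; apply: tN => _.
    by rewrite mindicE mem_set// mulr1.
apply: ereal_sup_ubound; exists (proj_nnsfun h mNc) => // t /=.
rewrite mindicE; have [Nt|Nt] := boolP (t \in ~` N); last first.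
  by rewrite mulr0 erestrict_ge0.
rewrite mulr1 (le_trans (hF t))//.
rewrite /patch; case: ifPn => // /set_mem Dt.
apply: contrapT => H; move/set_mem: Nt; apply; apply: FF' => /=.
by move=> /(_ Dt).
Qed.

End lower_integral.

Section finite_partition.
Context d (T : measurableType d) (R : realType) (X : normedModType R).
Variables (mu : {finite_measure set T -> \bar R}) (D : set T).
Hypothesis mD : measurable D.
Variables (I : finType) (q : T -> I).
Hypothesis mq : forall i, measurable (D `&` q @^-1` [set i]).

Let w i := fine (mu (D `&` q @^-1` [set i])).

Lemma measurable_cells (P : set I) : measurable (D `&` q @^-1` P).
Proof.
have -> : D `&` q @^-1` P = \bigcup_(i in P) (D `&` q @^-1` [set i]).
  apply/seteqP; split => [t [Dt Pt]|t [i Pi [Dt /= qt]]]; first by exists (q t).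
  by split => //=; rewrite qt.
by apply: fin_bigcup_measurable => //; exact: finite_finset.
Qed.

Lemma integral_cells (a : I -> R) : (forall i, 0 <= a i) ->
  (\int[mu]_(t in D) (a (q t))%:E = (\sum_i a i * w i)%:E)%E.
Proof.
move=> a0.
have m1 i : measurable_fun D
    (fun t => (\1_(D `&` q @^-1` [set i]) t)%:E : \bar R).
  by apply/measurable_EFinP; exact: measurable_indic.
under eq_integral => t /set_mem Dt.
  have -> : (a (q t))%:E =
      (\sum_i (a i)%:E * (\1_(D `&` q @^-1` [set i]) t)%:E)%E.
    rewrite (bigD1 (q t))//= indicE mem_set// mule1 big1 ?adde0// => i iqt.
    rewrite indicE memNset ?mule0// => -[_ /= /esym iq].
    by rewrite iq eqxx in iqt.
  over.
rewrite ge0_integral_sum//; last 2 first.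
- by move=> i; exact: measurable_funeM.
- by move=> i t Dt; rewrite mule_ge0// lee_fin.
rewrite -sumEFin; apply: eq_bigr => i _.
rewrite ge0_integralZl//; last by rewrite lee_fin.
rewrite integral_indic// setIAC setIid EFinM fineK//.
by rewrite fin_num_measure.
Qed.

Lemma measure_cells (P : pred I) :
  fine (mu (D `&` q @^-1` [set i | P i])) = \sum_(i | P i) w i.
Proof.
have := integral_cells (fun i => ler0n R (P i)).
under eq_integral => t /set_mem Dt.
  have -> : (P (q t))%:R = \1_(D `&` q @^-1` [set i | P i]) t :> R.
    rewrite indicE; case: (boolP (P (q t))) => Pq; first by rewrite mem_set.
    by rewrite memNset// => -[_ /= H]; rewrite H in Pq.
  over.
rewrite integral_indic//; last exact: measurable_cells.
rewrite setIAC setIid => -> /=; rewrite [RHS]big_mkcond; apply: eq_bigr => i _.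
by case: (P i); rewrite (mul1r, mul0r).
Qed.

(** Several cells may carry the same value of [F]; the sum over the range of
    [phi] groups them. *)
Lemma simple_integral_cells (F : I -> X) (phi : T -> X) :
  phi = F \o q -> bochner_simple D phi /\
  simple_integral mu D phi = \sum_i w i *: F i.
Proof.
move=> ->.
have fin : finite_set (range (F \o q)).
  apply: (@sub_finite_set _ _ (F @` setT)); last exact: finite_image.
  by move=> _ [t _ <-] /=; exists (q t).
split; first by split => // x; exact: measurable_cells (F @^-1` [set x]).
pose s := undup [seq F i | i <- index_enum I].
have mE x : D `&` (F \o q) @^-1` [set x] = D `&` q @^-1` [set i | F i == x].
  by apply/seteqP; split=> t [Dt] /=; [move=> ->|move/eqP].
rewrite /simple_integral (fsbig_widen _ [set` s])/=; last 2 first.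
- by move=> _ [t _ <-] /=; rewrite mem_undup map_f// mem_index_enum.
- move=> x [_ /= xn]; suff -> : D `&` (F \o q) @^-1` [set x] = set0.
    by rewrite measure0 scale0r.
  by rewrite -subset0 => t [_ /= tx]; apply: xn; exists t.
rewrite -fsbig_seq ?undup_uniq//.
under eq_bigr do rewrite mE measure_cells scaler_suml big_mkcond.
rewrite exchange_big/=; apply: eq_bigr => i _.
have Fis : F i \in s by rewrite mem_undup map_f// mem_index_enum.
rewrite (bigD1_seq (F i))//= ?undup_uniq// eqxx big1 ?addr0// => x xF.
by rewrite eq_sym (negbTE xF).
Qed.

End finite_partition.

(** The level sets of the pair of functions. *)
Lemma common_partition d (T : measurableType d) (R : realType)
    (X : normedModType R) (D : set T) (phi psi : T -> X) :
  bochner_simple D phi -> bochner_simple D psi ->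
  exists (I : finType) (q : T -> I) (F H : I -> X),
    [/\ forall i, measurable (D `&` q @^-1` [set i]),
        phi = F \o q & psi = H \o q].
Proof.
move=> [finphi mphi] [finpsi mpsi].
pose A := fset_set (range phi); pose B := fset_set (range psi).
have phiA t : phi t \in A by rewrite in_fset_set// mem_set//; exists t.
have psiB t : psi t \in B by rewrite in_fset_set// mem_set//; exists t.
exists (A * B)%type, (fun t => ([` phiA t]%fset, [` psiB t]%fset)).
exists (fun i => val i.1), (fun i => val i.2); split => //.
move=> [a b].
have -> : D `&` (fun t => ([` phiA t]%fset, [` psiB t]%fset)) @^-1` [set (a, b)]
    = (D `&` phi @^-1` [set val a]) `&` (D `&` psi @^-1` [set val b]).
  apply/seteqP; split=> t.
    by move=> [Dt /= [<- <-]].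
  by move=> [[Dt /= pa] [_ /= pb]]; split => //=; congr (_, _); exact: val_inj.
exact: measurableI.
Qed.

(** * Bochner integrals of uniform limits of simple functions *)

Section dual_norm.
Variables (R : realType) (X : normedModType R) (G : {linear X -> R^o}).
Hypothesis Gcont : continuous G.

Lemma dual_norm_ub (x : X) : `|x| <= 1 -> `|G x| <= dual_norm G.
Proof.
move=> x1; have /linear_boundedP : bounded_near G (nbhs (0 : X)).
  by apply/linear_bounded_continuous.
move=> /pinfty_ex_gt0[r r0 Gr]; apply: sup_upper_bound; last by exists x.
split; first by exists `|G x|, x.
exists r => _ [z /= z1 <-]; rewrite (le_trans (Gr z))//.
by rewrite ler_piMr// ltW.
Qed.

Lemma dual_norm_ge0 : 0 <= dual_norm G.
Proof. by rewrite (le_trans _ (@dual_norm_ub 0 _)) ?normr0. Qed.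

(** The supremum that defines the dual norm is finite because a continuous
    linear map is bounded near 0. *)
Lemma le_dual_norm (x : X) : `|G x| <= dual_norm G * `|x|.
Proof.
have [->|x0] := eqVneq x 0; first by rewrite linear0 !normr0 mulr0.
have nx0 : 0 < `|x| by rewrite normr_gt0.
rewrite -ler_pdivrMr//; have := @dual_norm_ub (`|x|^-1 *: x).
rewrite normrZ normfV normr_id mulVf ?gt_eqF// => /(_ (lexx _)).
by rewrite linearZ/= normrZ normfV normr_id mulrC.
Qed.

End dual_norm.

Lemma dist_pospart_le (R : realDomainType) (x y : R) :
  `|Num.max x 0 - Num.max y 0| <= `|x - y|.
Proof.
move: (ler_norm (x - y)) (ler_norm (y - x)); rewrite (distrC y) ler_norml.
by case: (leP x 0); case: (leP y 0); lra.
Qed.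

Section almost_uniform_limit.
Context d (T : measurableType d) (R : realType) (X : normedModType R).
Variables (mu : {finite_measure set T -> \bar R}) (D : set T).
Hypothesis mD : measurable D.
Implicit Types (f phi psi : T -> X) (e : R).

Let m := fine (mu D).

Lemma sum_cells (I : finType) (q : T -> I) :
  (forall i, measurable (D `&` q @^-1` [set i])) ->
  \sum_i fine (mu (D `&` q @^-1` [set i])) = m.
Proof.
move=> mq; have := measure_cells mu mD mq xpredT.
rewrite /m; set A := (X in D `&` X); suff -> : A = setT by rewrite setIT.
by rewrite -subTset.
Qed.

(** With [F] and [H] the values of [phi] and [psi] on a common partition, [`|F
    i - H i|] exceeds [`|f - psi|] on cell [i] by at most [e], off a null set.
    The positive part of [`|F i - H i| - e] is constant on cells and below [`|f
    - psi|], so its integral is below the lower integral of [`|f - psi|]. *)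
Lemma simple_integral_dist f phi psi e : 0 <= e ->
  bochner_simple D phi -> bochner_simple D psi ->
  {ae mu, forall t, D t -> `|f t - phi t| <= e} ->
  (`|simple_integral mu D phi - simple_integral mu D psi|%:E <=
    (e * m)%:E + \int[mu]_(t in D) `|f t - psi t|%:E)%E.
Proof.
move=> e0 sphi spsi fphi.
have [I [q [F [H [mq phiE psiE]]]]] := common_partition sphi spsi.
have [_ ->] := simple_integral_cells mu mD mq phiE.
have [_ ->] := simple_integral_cells mu mD mq psiE.
pose a i := Num.max 0 (`|F i - H i| - e).
have a0 i : 0 <= a i by rewrite le_max lexx.
have le_a : (\int[mu]_(t in D) (a (q t))%:E <=
             \int[mu]_(t in D) `|f t - psi t|%:E)%E.
  apply: ge0_ae_le_integral_lower.
  - by move=> t _; rewrite lee_fin.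
  - by move=> t _; rewrite lee_fin.
  apply: filterS fphi => t /[apply] ft; rewrite lee_fin ge_max normr_ge0/=.
  rewrite lerBlDr -[F _]/((F \o q) t) -[H _]/((H \o q) t) -phiE -psiE.
  rewrite (le_trans (ler_distD (f t) _ _))// addrC lerD2l.
  by rewrite distrC.
move: le_a; rewrite (integral_cells mu mD mq a0) => le_a.
apply: le_trans (leeD2l _ le_a); rewrite -EFinD lee_fin.
rewrite -sumrB (le_trans (ler_norm_sum _ _ _))//.
rewrite -(sum_cells mq) mulr_sumr -big_split/=; apply: ler_sum => i _.
rewrite -scalerBr normrZ ger0_norm ?fine_ge0// -mulrDl mulrC.
by rewrite ler_wpM2r ?fine_ge0// -lerBlDl le_max lexx orbT.
Qed.

Variables (f0 : T -> X) (phi : nat -> T -> X) (eps : nat -> R) (B : R).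
Hypothesis eps_cvg : eps @ \oo --> (0 : R).
Hypothesis eps_ge0 : forall n, 0 <= eps n.
Hypothesis phi_simple : forall n, bochner_simple D (phi n).
Hypothesis phi_f :
  {ae mu, forall t, D t -> forall n, `|f0 t - phi n t| <= eps n}.
Hypothesis phi_le : forall n, `|simple_integral mu D (phi n)| <= B.

Let phi_fn n : {ae mu, forall t, D t -> `|f0 t - phi n t| <= eps n}.
Proof. by apply: filterS phi_f => t /[apply]. Qed.

Let epsm_cvg : (eps n * m)%:E @[n --> \oo] --> 0%E.
Proof.
apply: cvg_EFin; first exact: nearW.
by rewrite -(mul0r m); apply: cvgM => //; exact: cvg_cst.
Qed.

Lemma almost_uniform_bochner_approx : bochner_approx mu D f0 phi.
Proof.
split=> //.
  apply: filterS phi_f => t /[apply] ft.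
  apply/cvgrPdist_le => e e0; have /cvgrPdist_le/(_ e e0) := eps_cvg.
  apply: filterS => n; rewrite sub0r normrN (ger0_norm (eps_ge0 n)).
  exact: le_trans.
apply: (@squeeze_cvge _ _ _ _ (cst 0%E) _ (fun n => (eps n * m)%:E)) => //;
  last exact: cvg_cst.
apply: nearW => n; apply/andP; split.
  by apply: integral_ge0 => t _; rewrite lee_fin.
rewrite EFinM /m fineK ?fin_num_measure// -integral_cst//.
apply: ge0_ae_le_integral_lower.
- by move=> t _; rewrite lee_fin.
- by move=> t _; rewrite lee_fin.
- by apply: filterS (phi_fn n) => t /[apply]; rewrite lee_fin.
Qed.

(** The Bochner integral is a limit of simple integrals along some unknown
    approximating sequence [psi]; [simple_integral_dist] compares each of them
    with the simple integral of [phi n]. *)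
Lemma norm_bochner_integral_le : `|bochner_integral mu D f0| <= B.
Proof.
rewrite /bochner_integral; case: xgetP => [I _ [psi [spsi _ fpsi] psiI]|_];
  last by rewrite normr0 (le_trans _ (phi_le 0)).
rewrite -lee_fin.
have bound n : (`|simple_integral mu D (psi n)|%:E <=
    B%:E + ((eps n * m)%:E + \int[mu]_(t in D) `|f0 t - psi n t|%:E))%E.
  have := simple_integral_dist (eps_ge0 n) (phi_simple n) (spsi n) (phi_fn n).
  move=> /(leeD2l `|simple_integral mu D (phi n)|%:E) H.
  apply: (@le_trans _ _ (`|simple_integral mu D (phi n)|%:E +
    ((eps n * m)%:E + \int[mu]_(t in D) `|f0 t - psi n t|%:E))%E).
    apply: le_trans H; rewrite -EFinD lee_fin -lerBlDl.
    by rewrite distrC lerB_dist.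
  by rewrite leeD2r// lee_fin.
have lim : (B%:E + ((eps n * m)%:E + \int[mu]_(t in D) `|f0 t - psi n t|%:E))%E
    @[n --> \oo] --> (B%:E + (0 + 0))%E.
  apply: cvgeD => //; first exact: cvg_cst.
  exact: cvgeD.
rewrite !adde0 in lim.
have psiIe : `|simple_integral mu D (psi n)|%:E @[n --> \oo] --> `|I|%:E.
  by apply: cvg_EFin; [exact: nearW | exact: cvg_norm].
by apply: (lee_cvg_to psiIe lim); exact: nearW.
Qed.

Variable G : {linear X -> R^o}.
Hypothesis Gcont : continuous G.

(** The map [P] stands for the positive or the negative part. Since [P \o G \o
    f0] is within [dual_norm G * eps n] of a function constant on cells, its
    lower integral is squeezed between two finite sums. *)
Lemma integral_lipschitz_functional (n : nat) (P : R -> R)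
    (I : finType) (q : T -> I) (F : I -> X) :
  (forall x, 0 <= P x) -> (forall x y, `|P x - P y| <= `|x - y|) ->
  (forall i, measurable (D `&` q @^-1` [set i])) -> phi n = F \o q ->
  exists2 r, (\int[mu]_(t in D) (P (G (f0 t)))%:E = r%:E)%E &
    `|r - \sum_i P (G (F i)) * fine (mu (D `&` q @^-1` [set i]))|
      <= dual_norm G * eps n * m.
Proof.
move=> P0 Plip mq phiE; set delta := dual_norm G * eps n.
have delta0 : 0 <= delta by rewrite mulr_ge0 ?dual_norm_ge0.
set w := fun i => fine (mu (D `&` q @^-1` [set i])).
have PGF : {ae mu, forall t, D t ->
    `|P (G (f0 t)) - P (G (F (q t)))| <= delta}.
  apply: filterS (phi_fn n) => t /[apply] ft.
  rewrite (le_trans (Plip _ _))// -linearB (le_trans (le_dual_norm Gcont _))//.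
  by rewrite ler_wpM2l ?dual_norm_ge0//; rewrite phiE in ft.
have up : (\int[mu]_(t in D) (P (G (f0 t)))%:E <=
    (\sum_i P (G (F i)) * w i + delta * m)%:E)%E.
  have -> : \sum_i P (G (F i)) * w i + delta * m =
      \sum_i (P (G (F i)) + delta) * w i.
    rewrite -(sum_cells mq) mulr_sumr -big_split; apply: eq_bigr => i _.
    by rewrite mulrDl.
  have H i : 0 <= P (G (F i)) + delta by rewrite addr_ge0.
  rewrite -(integral_cells mu mD mq H).
  apply: ge0_ae_le_integral_lower.
  - by move=> t _; rewrite lee_fin.
  - by move=> t _; rewrite lee_fin.
  - apply: filterS PGF => t /[apply]; rewrite lee_fin ler_distl => /andP[_].
    by [].
have down : ((\sum_i P (G (F i)) * w i - delta * m)%:E <=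
    \int[mu]_(t in D) (P (G (f0 t)))%:E)%E.
  have H i : 0 <= Num.max 0 (P (G (F i)) - delta) by rewrite le_max lexx.
  apply: (@le_trans _ _ (\sum_i Num.max 0 (P (G (F i)) - delta) * w i)%:E).
    rewrite lee_fin -(sum_cells mq) mulr_sumr -sumrB; apply: ler_sum => i _.
    by rewrite -mulrBl ler_wpM2r ?fine_ge0// le_max lexx orbT.
  rewrite -(integral_cells mu mD mq H).
  apply: ge0_ae_le_integral_lower.
  - by move=> t _; rewrite lee_fin.
  - by move=> t _; rewrite lee_fin.
  - apply: filterS PGF => t /[apply]; rewrite lee_fin ge_max P0/= ler_distl.
    by rewrite lerBlDr => /andP[+ _]; lra.
case: (integral _ _ _) up down => [r| |]//; rewrite !lee_fin => up down.
by exists r => //; rewrite ler_distl down.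
Qed.

Lemma abs_integral_functional_le :
  (`|\int[mu]_(t in D) (G (f0 t))%:E| <= (dual_norm G * B)%:E)%E.
Proof.
have bound n : (`|\int[mu]_(t in D) (G (f0 t))%:E| <=
    (dual_norm G * B)%:E + (dual_norm G *+ 2)%:E * (eps n * m)%:E)%E.
  have [I [q [F [_ [mq phiE _]]]]] :=
    common_partition (phi_simple n) (phi_simple n).
  pose w i := fine (mu (D `&` q @^-1` [set i])).
  have [||rp pE rpP] :=
    @integral_lipschitz_functional n (Num.max^~ 0) I q F _ _ mq phiE.
  - by move=> x; rewrite le_max lexx orbT.
  - exact: dist_pospart_le.
  have [||rn nE rnP] := @integral_lipschitz_functional n
    (fun x => Num.max (- x) 0) I q F _ _ mq phiE.
  - by move=> x; rewrite le_max lexx orbT.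
  - by move=> x y; rewrite (le_trans (dist_pospart_le _ _))// -opprD normrN.
  have -> : (\int[mu]_(t in D) (G (f0 t))%:E = (rp - rn)%:E)%E.
    rewrite integralE EFinB -pE -nE.
    by congr (_ - _)%E; apply: eq_integral => t _;
      rewrite (funeposE, funenegE) EFin_max ?EFinN.
  have siE : G (simple_integral mu D (phi n)) = \sum_i G (F i) * w i.
    have [_ ->] := simple_integral_cells mu mD mq phiE.
    by rewrite linear_sum; apply: eq_bigr => i _; rewrite linearZ/= mulrC.
  have sE : \sum_i G (F i) * w i =
    \sum_i Num.max (G (F i)) 0 * w i - \sum_i Num.max (- G (F i)) 0 * w i.
    rewrite -sumrB; apply: eq_bigr => i _; rewrite -mulrBl; congr (_ * _).
    by case: (leP (G (F i)) 0); case: (leP (- G (F i)) 0); lra.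
  have siB : `|G (simple_integral mu D (phi n))| <= dual_norm G * B.
    by rewrite (le_trans (le_dual_norm Gcont _))// ler_wpM2l ?dual_norm_ge0.
  rewrite -EFinM -EFinD lee_fin; move: siB rpP rnP.
  rewrite siE sE -/w !ler_norml mulr2n; lra.
have lim : ((dual_norm G * B)%:E + (dual_norm G *+ 2)%:E * (eps n * m)%:E)%E
    @[n --> \oo] --> ((dual_norm G * B)%:E + (dual_norm G *+ 2)%:E * 0)%E.
  apply: cvgeD; [by rewrite mule0|exact: cvg_cst|exact: cvgeZl].
rewrite mule0 adde0 in lim.
by apply: (lee_cvg_to (cvg_cst _) lim); exact: nearW.
Qed.

End almost_uniform_limit.

(** * Tails of monotone summable sequences *)

Section lp_sequences.
Variables (R : realType) (p : R) (b : nat -> R).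
Hypotheses (p_gt0 : 0 < p) (p_lt1 : p < 1).
Hypotheses (b_ge0 : forall j, 0 <= b j) (b_dec : nonincreasing_seq b).
Variable S : R.
Hypothesis bS : forall n, \sum_(0 <= j < n) b j `^ p <= S.

Let S_ge0 : 0 <= S. Proof. by have := bS 0; rewrite big_nil. Qed.

Lemma powR_split (x r : R) : 0 <= x -> p < r -> x `^ r = x `^ p * x `^ (r - p).
Proof.
move=> x0 pr; rewrite -powRD; first by congr (_ `^ _); lra.
by rewrite addrC subrK gt_eqF// (lt_trans p_gt0).
Qed.

(** The term of index [s] is the smallest of the first [s.+1]. *)
Lemma lp_monotone_decay (s : nat) : s.+1%:R * b s `^ p <= S.
Proof.
apply: le_trans (bS s.+1).
rewrite mulr_natl -[s.+1 in X in X <= _](subn0 s.+1) -sumr_const_nat.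
apply: ler_sum_nat => j /andP[_ js]; apply: ge0_ler_powR; rewrite ?nnegrE//.
  exact: ltW.
exact: b_dec.
Qed.

Lemma lp_sum_bound (n : nat) :
  \sum_(0 <= j < n) b j <= S * b 0 `^ (1 - p).
Proof.
apply: (@le_trans _ _ ((\sum_(0 <= j < n) b j `^ p) * b 0 `^ (1 - p))).
  rewrite mulr_suml; apply: ler_sum => j _.
  rewrite -[leLHS]powRr1// (powR_split (b_ge0 j) p_lt1) ler_wpM2l ?powR_ge0//.
  apply: ge0_ler_powR; rewrite ?nnegrE//; first by rewrite subr_ge0 ltW.
  exact: b_dec.
by rewrite ler_wpM2r ?powR_ge0.
Qed.

(** Split [b j ^+ 2 = b j `^ p * b j `^ (2 - p)]: the first factor is summable,
    and the second is at most [b s `^ (2 - p)], which [lp_monotone_decay]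
    bounds by a power of [S / s]. *)
Lemma lp_square_tail (s n : nat) : (0 < s)%N ->
  \sum_(s <= j < n) b j ^+ 2 <= S * S `^ (2 / p - 1) * s%:R `^ (- (2 / p) + 1).
Proof.
move=> s0; have s0R : 0 < s%:R :> R by rewrite ltr0n.
have p2 : p < 2 by rewrite (lt_trans p_lt1)// ltr1n.
have e0 : 0 <= 2 / p - 1 by rewrite subr_ge0 ler_pdivlMr// mul1r ltW.
have bs : b s `^ (2 - p) <= S `^ (2 / p - 1) * s%:R `^ (- (2 / p) + 1).
  have -> : 2 - p = p * (2 / p - 1) by field; rewrite gt_eqF.
  rewrite powRrM [- (2 / p) + 1](_ : _ = -1 * (2 / p - 1)); last by lra.
  rewrite [s%:R `^ _]powRrM powR_inv1 ?ler0n// -powRM ?invr_ge0//.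
  apply: ge0_ler_powR; rewrite ?nnegrE ?powR_ge0 ?divr_ge0//.
  rewrite ler_pdivlMr// mulrC (le_trans _ (lp_monotone_decay s))//.
  by rewrite ler_wpM2r ?powR_ge0// ler_nat.
apply: (@le_trans _ _ ((\sum_(s <= j < n) b j `^ p) * b s `^ (2 - p))).
  rewrite mulr_suml; apply: ler_sum_nat => j /andP[sj _].
  rewrite -powR_mulrn// (powR_split (b_ge0 j) p2) ler_wpM2l ?powR_ge0//.
  apply: ge0_ler_powR; rewrite ?nnegrE//; first by rewrite subr_ge0 ltW.
  exact: b_dec.
rewrite -mulrA ler_pM ?sumr_ge0 ?powR_ge0// => [j _|]; first exact: powR_ge0.
have [sn|ns] := leqP s n; last by rewrite big_geq// ltnW.
apply: le_trans (bS n); rewrite [leRHS](big_cat_nat (n := s))//=.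
by rewrite lerDr sumr_ge0// => j _; exact: powR_ge0.
Qed.

End lp_sequences.

(** * The symmetric grid of [-1, 1] *)

Section grid.
Variables (R : realType) (N : nat).
Implicit Types (x : R) (i : 'I_N.+1).

Definition grid_point (i : 'I_N.+1) : R := i.*2.+1%:R / N.+1%:R - 1.

(** The cells are closed on the left and open on the right, except for the last
    one, which contains the end point 1. *)
Definition grid_cell (i : 'I_N.+1) : set R :=
  [set` Interval (BLeft (i.*2%:R / N.+1%:R - 1))
                 (BSide (i != N :> nat) (i.+1.*2%:R / N.+1%:R - 1))].

(** The minimum with [N] sends the end point 1 to the last cell. *)
Definition grid_index (x : R) : 'I_N.+1 :=
  inord (minn N (Num.truncn ((x + 1) / 2 * N.+1%:R))).

Let N0 : 0 < N.+1%:R :> R. Proof. by rewrite ltr0n. Qed.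

Let double (n : nat) : n.*2%:R = n%:R * 2 :> R.
Proof. by rewrite -muln2 natrM. Qed.

Lemma grid_point_rev i : grid_point (rev_ord i) = - grid_point i.
Proof.
rewrite /grid_point /= subSS -!natr1 !double natrB -1?ltnS// mulrBl.
have : N%:R + 1 != 0 :> R by rewrite natr1 gt_eqF.
by move=> ?; field.
Qed.

Lemma grid_point_itv i : grid_point i \in `[-1, 1].
Proof.
rewrite in_itv/= /grid_point lerBrDl subrr divr_ge0 ?ler0n//=.
rewrite lerBlDr ler_pdivrMr// -[1 + 1]/(2%:R) -natrM ler_nat mul2n.
by rewrite ltn_double.
Qed.

Lemma grid_cell_dist i x : grid_cell i x -> `|x - grid_point i| <= N.+1%:R^-1.
Proof.
rewrite /grid_cell/= in_itv/= => /andP[ix /lteifW].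
rewrite doubleS -[i.*2.+2%:R]natr1 -[i.*2.+1%:R]natr1 !mulrDl div1r => xi.
rewrite /grid_point -[i.*2.+1%:R]natr1 mulrDl div1r.
move: ix xi; set a := i.*2%:R / _; set e := _^-1 => ix xi.
by rewrite ler_distl; apply/andP; split; lra.
Qed.

Lemma grid_cell_sub i : grid_cell i `<=` `[-1, 1].
Proof.
move=> x; rewrite /grid_cell/= !in_itv/= => /andP[ix /lteifW xi].
apply/andP; split.
  by rewrite (le_trans _ ix)// lerBrDl subrr divr_ge0.
rewrite (le_trans xi)// lerBlDr ler_pdivrMr// -[1 + 1]/(2%:R) -natrM ler_nat.
by rewrite mul2n leq_double.
Qed.

Lemma grid_indexE i x : x \in `[-1, 1] ->
  (grid_index x == i) = (x \in grid_cell i).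
Proof.
rewrite in_itv/= => /andP[x1 x2].
set z := (x + 1) / 2 * N.+1%:R.
have z0 : 0 <= z by rewrite mulr_ge0// divr_ge0//; lra.
have zi (k : nat) : (k%:R <= z) = (k.*2%:R / N.+1%:R - 1 <= x).
  rewrite /z lerBlDr ler_pdivrMr// double -[in RHS]ler_pdivlMr//.
  by rewrite mulrAC.
apply/idP/idP => [/eqP <-|].
  rewrite inE /grid_cell/= in_itv/=.
  rewrite inordK ?ltnS ?geq_minl// -/z.
  have zt := truncn_itv z0.
  have [Nt|tN] := leqP N (Num.truncn z).
    rewrite eqxx/= -zi -truncn_ge_nat// Nt/=.
    by rewrite (double N.+1) mulrAC divff ?gt_eqF//; lra.
  rewrite (ltn_eqF tN)/= -zi ltNge -zi -ltNge.
  by case/andP: zt => -> ->.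
rewrite inE /grid_cell/= in_itv/= -zi => /andP[iz xi].
apply/eqP/val_inj; rewrite /= inordK ?ltnS ?geq_minl// -/z.
have it : (i <= Num.truncn z)%N by rewrite truncn_ge_nat.
move: xi; have [iN _|iN] /= := eqVneq (i : nat) N.
  by rewrite iN in it *; exact/minn_idPl.
rewrite ltNge -zi -ltNge => zi1.
have -> : Num.truncn z = i by apply: truncn_def; rewrite iz.
by apply/minn_idPr; rewrite -ltnS.
Qed.

Lemma uniform_grid_cell i :
  uniform_prob (ltrN1_1 R) (grid_cell i) = (N.+1%:R^-1)%:E.
Proof.
have mcell : measurable (grid_cell i : set (measurableTypeR R)).
  exact: measurable_itv.
rewrite /uniform_prob; under eq_integral => x /set_mem xi.
  have -> : uniform_pdf (-1) 1 x = 2^-1 :> R.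
    rewrite /uniform_pdf; have := grid_cell_sub xi; rewrite /= in_itv/= => ->.
    by rewrite opprK.
  over.
rewrite integral_cst//= /grid_cell lebesgue_measure_itv/= lte_fin.
rewrite ltrD2r ltr_pM2r ?invr_gt0// ltr_nat ltn_double ltnSn -EFinB -EFinM.
congr EFin; rewrite !double -natr1 -[N.+1%:R]natr1.
have : N%:R + 1 != 0 :> R by rewrite natr1 gt_eqF.
by move=> ?; field.
Qed.

End grid.

(** * Product grid cells under the uniform product measure *)

Section product_measure.
Variable R : realType.
Local Notation T := (g_sigma_algebraType (coordinate_sets R)).
Implicit Type B : nat -> set (measurableTypeR R).

Lemma measurable_coordinate (j : nat) (S : set (measurableTypeR R)) :
  measurable S -> measurable ([set y | S (y j)] : set T).
Proof.
move=> mS; apply: sub_sigma_algebra; exists j => //.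
by exists S => //; rewrite setTI.
Qed.

Lemma measurable_cylinder (n : nat) B : (forall j, measurable (B j)) ->
  measurable ([set y | forall j, (j < n)%N -> B j (y j)] : set T).
Proof.
move=> mB.
have -> : [set y | forall j, (j < n)%N -> B j (y j)] =
    \bigcap_(j in `I_n) [set y | B j (y j)] by [].
by apply: bigcap_measurableType => // j _; exact: measurable_coordinate.
Qed.

Lemma measurable_cube : measurable (@cube R : set T).
Proof.
have -> : @cube R = \bigcap_j [set y | y j \in `[-1, 1]].
  by apply/seteqP; split=> y yc j => [_|]; exact: yc.
apply: bigcap_measurableType => // j _.
by apply: (@measurable_coordinate j `[-1, 1]); exact: measurable_itv.
Qed.

Variable gamma : probability T R.
Hypothesis gammaP : is_uniform_product gamma.

(** A countable union of the null events that one coordinate leaves [-1, 1]. *)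
Lemma gamma_setC_cube : gamma (~` @cube R) = 0%E.
Proof.
apply/(negligibleP gamma); first exact: measurableC measurable_cube.
suff: gamma.-negligible (\bigcup_j ([set y | ~ (y j \in `[-1, 1])] : set T)).
  by apply: negligibleS => y /existsNP[j yj]; exists j.
apply: negligible_bigcup => j.
pose B i : set (measurableTypeR R) := if i == j then ~` `[-1, 1] else setT.
have mB i : measurable (B i).
  by rewrite /B; case: ifP => // _; apply: measurableC; exact: measurable_itv.
exists [set y | forall i, (i < j.+1)%N -> B i (y i)]; split.
- exact: measurable_cylinder.
- etransitivity; first exact: (gammaP j.+1 mB).
  rewrite big_ord_recr/= {2}/B eqxx.
  have -> : uniform_prob (ltrN1_1 R) (~` `[-1, 1]) = 0%E.
    rewrite /uniform_prob integral_uniform_pdf setICl integral_set0//.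
  by rewrite mule0.
- by move=> y /= yj i _; rewrite /B; case: eqP => // ->.
Qed.

Lemma gamma_cubeI (S : set T) : measurable S -> gamma (@cube R `&` S) = gamma S.
Proof.
move=> mS; rewrite [RHS](measureDI gamma mS measurable_cube) setIC.
rewrite [X in (X + _)%E](_ : _ = 0%E) ?add0e//.
apply: (subset_measure0 _ _ _ gamma_setC_cube).
- exact: measurableD mS measurable_cube.
- exact: measurableC measurable_cube.
- by move=> y [].
Qed.

Section grid_approximation.
Variables n N : nat.

Definition grid_cell_of (y : nat -> R) : {ffun 'I_n -> 'I_N.+1} :=
  [ffun i : 'I_n => grid_index N (y i)].

Definition grid_seq (c : {ffun 'I_n -> 'I_N.+1}) : nat -> R :=
  fun j => if insub j is Some i then grid_point R (c i) else 0.

Lemma grid_seq_ord c (i : 'I_n) : grid_seq c i = grid_point R (c i).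
Proof. by rewrite /grid_seq valK. Qed.

Lemma grid_seq_out c j : (n <= j)%N -> grid_seq c j = 0.
Proof. by move=> nj; rewrite /grid_seq insubF// ltnNge nj. Qed.

Lemma grid_seq_cube c : cube (grid_seq c).
Proof.
move=> j; rewrite /grid_seq; case: insubP => [i _ _|_].
  exact: grid_point_itv.
by rewrite in_itv/=; lra.
Qed.

Let B (c : {ffun 'I_n -> 'I_N.+1}) (j : nat) : set (measurableTypeR R) :=
  if insub j is Some i then @grid_cell R N (c i) else setT.

Let mB c j : measurable (B c j).
Proof. by rewrite /B; case: insub => // i; exact: measurable_itv. Qed.

Let cellE c : @cube R `&` grid_cell_of @^-1` [set c] =
  @cube R `&` [set y | forall j, (j < n)%N -> B c j (y j)].
Proof.
apply/seteqP; split => y [yc /= yC]; split => //=.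
  move=> j jn; rewrite /B insubT/= -yC ffunE.
  by apply/set_mem; rewrite -(grid_indexE _ (yc j)).
apply/ffunP => i; rewrite ffunE; apply/eqP.
rewrite (grid_indexE _ (yc i)); apply/mem_set.
by have := yC i (ltn_ord i); rewrite /B valK.
Qed.

Lemma measurable_grid_cell_of c :
  measurable ((@cube R `&` grid_cell_of @^-1` [set c]) : set T).
Proof.
rewrite cellE; apply: measurableI; first exact: measurable_cube.
exact: measurable_cylinder.
Qed.

(** Up to the null complement of the cube, a grid cell is a cylinder over a
    product of intervals of mass [N.+1%:R^-1]. *)
Lemma gamma_grid_cell_of c :
  gamma (@cube R `&` grid_cell_of @^-1` [set c]) = (N.+1%:R^-1 ^+ n)%:E.
Proof.
rewrite cellE gamma_cubeI; last exact: measurable_cylinder.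
rewrite gammaP//; under eq_bigr => i _ do rewrite /B valK uniform_grid_cell.
by rewrite prodEFin prodr_const card_ord.
Qed.

Lemma grid_seq_dist (y : nat -> R) (i : 'I_n) : cube y ->
  `|y i - grid_seq (grid_cell_of y) i| <= N.+1%:R^-1.
Proof.
move=> yc; rewrite grid_seq_ord ffunE; apply: grid_cell_dist.
by apply/set_mem; rewrite -(grid_indexE _ (yc i)).
Qed.

End grid_approximation.
End product_measure.

(** * Variation of a function on the cube along single coordinates *)

Section coordinate_update.
Variable R : realType.
Implicit Types (y : nat -> R) (t : R).

Definition upd y (j : nat) t : nat -> R := [eta y with j |-> t].

Lemma updE y j t i : upd y j t i = if i == j then t else y i.
Proof. by []. Qed.

Lemma upd_upd y j t t' : upd (upd y j t) j t' = upd y j t'.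
Proof. by apply/funext => i; rewrite !updE; case: eqP. Qed.

Lemma upd_id y j t : y j = t -> upd y j t = y.
Proof. by move=> yj; apply/funext => i; rewrite updE; case: eqP => // ->. Qed.

Lemma cube_upd y j t : cube y -> t \in `[-1, 1] -> cube (upd y j t).
Proof. by move=> yc tI i; rewrite updE; case: eqP => _ //; exact: yc. Qed.

Lemma cube_truncate s y : cube y -> cube (truncate s y).
Proof.
move=> yc i; rewrite /truncate; case: ifP => _; first exact: yc.
by rewrite in_itv/=; lra.
Qed.

Lemma truncateS s y : truncate s.+1 y = upd (truncate s y) s (y s).
Proof.
apply/funext => i; rewrite updE /truncate ltnS leq_eqVlt.
by case: eqP => [->|].
Qed.

Lemma norm_cube y j : cube y -> `|y j| <= 1.
Proof. by move=> /(_ j); rewrite in_itv/= ler_norml. Qed.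

End coordinate_update.

Section single_coordinate.
Variables (R : realType) (X : normedModType R).
Implicit Type f : (nat -> R) -> X.

Lemma derivative_on_partial f j y :
  (forall z, cube z -> has_partial j f z) -> cube y ->
  derivative_on (fun t => f (upd y j t)) (fun t => partial j f (upd y j t)).
Proof.
move=> hf yc c cI; have := hf _ (cube_upd j yc cI).
rewrite /has_partial /partial -/(upd y j c) [upd y j c j]updE eqxx.
suff -> : difference_quotient j f (upd y j c) =
    (fun t => (t - c)^-1 *: (f (upd y j t) - f (upd y j c))) by [].
apply/funext => t; rewrite /difference_quotient -/(upd (upd y j c) j t).
by rewrite upd_upd updE eqxx.
Qed.

Definition single_index (j m : nat) : multi_index :=
  [fsfun i in [fset j]%fset => m | 0%N]%fsfun.

Lemma finsupp_single_index j m : (0 < m)%N ->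
  finsupp (single_index j m) = [fset j]%fset.
Proof.
move=> m0; apply/fsetP => i; rewrite mem_finsupp fsfunE in_fset1.
by case: (i == j); rewrite ?eqxx -?lt0n.
Qed.

Lemma single_indexE j m : single_index j m j = m.
Proof. by rewrite fsfunE in_fset1 eqxx. Qed.

Lemma multi_order_single j m : (0 < m)%N -> multi_order (single_index j m) = m.
Proof.
move=> m0; rewrite /multi_order finsupp_single_index//.
by rewrite big_seq_fset1 single_indexE.
Qed.

Lemma multi_power_single (b : nat -> R) j m : (0 < m)%N ->
  multi_power b (single_index j m) = b j ^+ m.
Proof.
move=> m0; rewrite /multi_power finsupp_single_index//.
by rewrite big_seq_fset1 single_indexE.
Qed.

Lemma mixed_partial_single f j m : (0 < m)%N ->
  mixed_partial (single_index j m) f = partials (nseq m j) f.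
Proof.
move=> m0; rewrite /mixed_partial finsupp_single_index// -fset_seq1/=.
by rewrite single_indexE cats0.
Qed.

End single_coordinate.

Section coordinatewise_smooth.
Variables (R : realType) (X : normedModType R) (g : (nat -> R) -> X).
Variables (L K : nat -> R).
Hypothesis g1 : forall j y, cube y -> has_partial j g y.
Hypothesis g2 : forall j y, cube y -> has_partial j (partial j g) y.
Hypothesis gL : forall j y, cube y -> `|partial j g y| <= L j.
Hypothesis gK : forall j y, cube y -> `|partial j (partial j g) y| <= K j.

(** Move the coordinates below [n] from [y] to [z] one at a time, and apply the
    mean value inequality to each move. *)
Lemma lipschitz_on_cube n y z : cube y -> cube z ->
  (forall j, (n <= j)%N -> y j = z j) ->
  `|g y - g z| <= \sum_(0 <= j < n) L j * `|y j - z j|.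
Proof.
elim: n y => [|n IH] y yc zc yz.
  rewrite big_nil; suff -> : y = z by rewrite subrr normr0.
  by apply/funext => j; exact: yz.
have wc : cube (upd y n (z n)) by exact: cube_upd.
rewrite -(subrK (g (upd y n (z n))) (g y)) -addrA.
rewrite (le_trans (ler_normD _ _))// big_nat_recr//= [leRHS]addrC.
rewrite lerD//; last first.
  rewrite (le_trans (IH _ wc zc _))//.
    move=> j; rewrite updE; case: eqP => [->//|/eqP jn nj].
    by apply: yz; rewrite ltn_neqAle eq_sym jn.
  apply: ler_sum_nat => j /andP[_ jn].
  by rewrite updE (ltn_eqF jn).
have := lipschitz_of_derivative_bound
  (derivative_on_partial (@g1 n) yc) _ (zc n) (yc n).
by rewrite (upd_id (erefl (y n))); apply=> c cI; apply: gL; exact: cube_upd.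
Qed.

Lemma second_difference_on_cube j y t : cube y -> t \in `[-1, 1] ->
  `|g (upd y j t) + g (upd y j (- t)) - g (upd y j 0) *+ 2| <= K j *+ 2.
Proof.
move=> yc tI.
apply: (second_difference_bound (derivative_on_partial (@g1 j) yc)
          (derivative_on_partial (@g2 j) yc) _ tI).
by move=> c cI; apply: gK; exact: cube_upd.
Qed.

Section grid_sum.
Variables n N : nat.
Local Notation grid := {ffun 'I_n -> 'I_N.+1}.
Local Notation pt := (@grid_seq R n N).

Definition flip (i : 'I_n) (c : grid) : grid :=
  [ffun j => if j == i then rev_ord (c j) else c j].

Lemma flipK i : involutive (flip i).
Proof.
move=> c; apply/ffunP => j; rewrite !ffunE.
by case: eqP => // _; rewrite rev_ordK.
Qed.

Lemma grid_seq_flip i c j :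
  pt (flip i c) j = if j == i :> nat then - pt c j else pt c j.
Proof.
rewrite /grid_seq; case: insubP => [k kn <-|nj].
  by rewrite ffunE -val_eqE; case: eqP => // _; rewrite grid_point_rev.
by case: ifP => //; rewrite oppr0.
Qed.

Lemma truncate_grid_seq s c : (n <= s)%N -> truncate s (pt c) = pt c.
Proof.
move=> ns; apply/funext => j; rewrite /truncate; case: ltnP => // sj.
by rewrite grid_seq_out// (leq_trans ns).
Qed.

(** The reflection [flip i] permutes the grid, so twice the sum is the sum of
    the increments at [c] and at [flip i c]. Both start from the same point,
    which ignores coordinate [i], and their sum is a second difference. *)
Lemma grid_sum_increment (i : 'I_n) :
  `|\sum_c (g (truncate i.+1 (pt c)) - g (truncate i (pt c)))|
    <= K i * (N.+1 ^ n)%:R.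
Proof.
set A := \sum_c _.
suff A2 : A *+ 2 = \sum_c
    (g (upd (truncate i (pt c)) i (pt c i))
     + g (upd (truncate i (pt c)) i (- pt c i))
     - g (upd (truncate i (pt c)) i 0) *+ 2).
  have : `|A *+ 2| <= (K i * (N.+1 ^ n)%:R) *+ 2.
    rewrite A2 (le_trans (ler_norm_sum _ _ _))//.
    apply: (@le_trans _ _ (\sum_(c : grid) K i *+ 2)).
      apply: ler_sum => c _; apply: second_difference_on_cube.
        exact/cube_truncate/grid_seq_cube.
      exact: grid_seq_cube.
    by rewrite sumr_const card_ffun !card_ord mulr_natr mulrnAC.
  by rewrite normrMn ler_pMn2r.
rewrite mulr2n {2}/A (reindex_inj (inv_inj (flipK i))) -big_split/=.
apply: eq_bigr => c _.
have -> : truncate i (pt (flip i c)) = truncate i (pt c).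
  apply/funext => j; rewrite /truncate; case: ltnP => // ji.
  by rewrite grid_seq_flip (ltn_eqF ji).
rewrite !truncateS grid_seq_flip eqxx.
have -> : truncate i (pt (flip i c)) = truncate i (pt c).
  apply/funext => j; rewrite /truncate; case: ltnP => // ji.
  by rewrite grid_seq_flip (ltn_eqF ji).
rewrite (@upd_id _ _ i 0); last by rewrite /truncate ltnn.
by rewrite mulr2n opprD addrACA.
Qed.

Lemma grid_sum_truncation s :
  `|\sum_c (g (pt c) - g (truncate s (pt c)))|
    <= (\sum_(s <= m < n) K m) * (N.+1 ^ n)%:R.
Proof.
have [ns|sn] := ltnP n s.
  rewrite big_geq ?(ltnW ns)// mul0r big1 ?normr0// => c _.
  by rewrite truncate_grid_seq ?subrr// ltnW.
have -> : \sum_c (g (pt c) - g (truncate s (pt c))) =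
    \sum_(s <= m < n) \sum_c (g (truncate m.+1 (pt c)) - g (truncate m (pt c))).
  rewrite exchange_big; apply: eq_bigr => c _.
  rewrite (telescope_sumr (fun m => g (truncate m (pt c))))//.
  by rewrite [truncate n _]truncate_grid_seq.
rewrite mulr_suml (le_trans (ler_norm_sum _ _ _))//.
apply: ler_sum_nat => m /andP[_ mn].
exact: (grid_sum_increment (Ordinal mn)).
Qed.

End grid_sum.
End coordinatewise_smooth.

(** * Rounding to the grid, and the truncation error *)

Section rounding.
Variables (R : realType) (X : normedModType R) (g : (nat -> R) -> X).
Variable L : nat -> R.
Hypothesis L_ge0 : forall j, 0 <= L j.
Hypothesis L_cvg : cvgn (series L).
Hypothesis hg : forall j y, cube y -> has_partial j g y.
Hypothesis gL : forall j y, cube y -> `|partial j g y| <= L j.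

(** The first term is the cost of moving each of the first [n] coordinates by
    at most [n.+1%:R^-1], the second that of changing all the others. *)
Definition rounding_error (n : nat) : R :=
  limn (series L) * n.+1%:R^-1 + (limn (series L) - series L n).

Let series_le n : series L n <= limn (series L).
Proof.
apply: nondecreasing_cvgn_le => //; apply/nondecreasing_seqP => m.
by rewrite seriesSr lerDl.
Qed.

Lemma rounding_error_ge0 n : 0 <= rounding_error n.
Proof.
rewrite addr_ge0 ?subr_ge0// mulr_ge0//.
by rewrite (le_trans _ (series_le 0))// /series/= big_nil.
Qed.

Lemma rounding_error_cvg0 : rounding_error @ \oo --> (0 : R).
Proof.
have -> : 0 = limn (series L) * 0 + (limn (series L) - limn (series L)) :> R.
  by rewrite mulr0 subrr addr0.
apply: cvgD; first exact: cvgMr cvg_harmonic.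
by apply: cvgB => //; exact: cvg_cst.
Qed.

Definition close_to_order (n : nat) (y z : nat -> R) :=
  forall j, `|y j - z j| <= if (j < n)%N then n.+1%:R^-1 else 1.

(** The bound does not depend on [m]. It therefore passes to the limit of [m]
    going to infinity, and it also holds for the truncation [g_s] with [s]
    fixed. *)
Lemma truncate_rounding_dist n m y z : cube y -> cube z ->
  close_to_order n y z ->
  `|g (truncate m y) - g (truncate m z)| <= rounding_error n.
Proof.
move=> yc zc yz.
have nM : (n <= maxn m n)%N by rewrite leq_maxr.
have agree j : (maxn m n <= j)%N -> truncate m y j = truncate m z j.
  by rewrite geq_max /truncate ltnNge => /andP[-> _].
have dist_trunc j : `|truncate m y j - truncate m z j| <= `|y j - z j|.
  by rewrite /truncate; case: ifP => // _; rewrite subrr normr0.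
rewrite (le_trans (lipschitz_on_cube hg gL (cube_truncate m yc)
  (cube_truncate m zc) agree))//.
rewrite (big_cat_nat (n := n))//= lerD//.
  apply: (@le_trans _ _ (\sum_(0 <= j < n) L j * n.+1%:R^-1)).
    apply: ler_sum_nat => j /andP[_ jn]; rewrite ler_wpM2l//.
    by rewrite (le_trans (dist_trunc j))//; have := yz j; rewrite jn.
  by rewrite -mulr_suml ler_wpM2r ?invr_ge0//; exact: series_le.
apply: (@le_trans _ _ (series L (maxn m n) - series L n)).
  rewrite sub_series_geq//; apply: ler_sum_nat => j /andP[nj jm].
  rewrite ler_piMr// (le_trans (dist_trunc j))//.
  by have := yz j; rewrite ltnNge nj.
by rewrite lerD2r.
Qed.

Lemma close_to_order_grid n y : cube y ->
  close_to_order n y (grid_seq R (grid_cell_of n n y)).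
Proof.
move=> yc j; case: ltnP => jn; last by rewrite grid_seq_out// subr0 norm_cube.
exact: (@grid_seq_dist R n n y (Ordinal jn)).
Qed.

Lemma grid_rounding_dist n y : cube y ->
  `|g y - g (truncate s y)| @[s --> \oo] --> (0 : R) ->
  `|g y - g (grid_seq R (grid_cell_of n n y))| <= rounding_error n.
Proof.
move=> yc gy; set z := grid_seq _ _.
apply/ler_addgt0Pl => e e0.
have near_m : \forall m \near \oo, `|g y - g (truncate m y)| <= e /\ (n <= m)%N.
  near=> m; split; last by near: m; exact: nbhs_infty_ge.
  near: m; have /cvgr0Pnorm_le/(_ e e0) := gy.
  by apply: filterS => m; rewrite normr_id.
have [m [ym nm]] := filter_ex near_m.
rewrite -(subrK (g (truncate m y)) (g y)) -addrA.
rewrite (le_trans (ler_normD _ _))// lerD// -[z](@truncate_grid_seq _ _ _ m)//.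
apply: truncate_rounding_dist => //; first exact: grid_seq_cube.
exact: close_to_order_grid.
Unshelve. all: by end_near. Qed.

End rounding.

(** All the cells have mass [N.+1%:R^-1 ^+ n]: the simple integral is the plain
    average over the grid points. *)
Lemma norm_grid_simple_integral (R : realType) (X : normedModType R)
    (gamma : probability (g_sigma_algebraType (coordinate_sets R)) R)
    (n N : nat) (f : (nat -> R) -> X) (B : R) :
  is_uniform_product gamma ->
  `|\sum_(c : {ffun 'I_n -> 'I_N.+1}) f (grid_seq R c)| <= B * (N.+1 ^ n)%:R ->
  bochner_simple (cube : set (g_sigma_algebraType (coordinate_sets R)))
    (f \o (@grid_seq R n N \o @grid_cell_of R n N)) /\
  `|simple_integral gamma cube (f \o (@grid_seq R n N \o @grid_cell_of R n N))|
    <= B.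
Proof.
move=> gammaP fB; pose q := @grid_cell_of R n N.
have mq c : measurable ((cube `&` q @^-1` [set c]) :
    set (g_sigma_algebraType (coordinate_sets R))).
  exact: measurable_grid_cell_of.
have [sphi ->] := simple_integral_cells (phi := f \o (@grid_seq R n N \o q))
  gamma (@measurable_cube R) mq (F := f \o @grid_seq R n N) erefl.
split => //.
have M0 : 0 < N.+1%:R ^+ n :> R by rewrite exprn_gt0.
under eq_bigr => c _.
  have -> : fine (gamma (cube `&` q @^-1` [set c])) = N.+1%:R^-1 ^+ n.
    by rewrite (congr1 fine (gamma_grid_cell_of gammaP c)).
  over.
rewrite -scaler_sumr normrZ ger0_norm ?exprn_ge0// exprVn.
by rewrite ler_pdivrMl// mulrC -natrX.
Qed.

Theorem theorem4p3
    (R : realType) (X : completeNormedModType R) (Xsep : separable_space X)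
    (gamma : probability (g_sigma_algebraType (coordinate_sets R)) R)
    (gammaP : is_uniform_product gamma)
    (g : (nat -> R) -> X)
    (p : R) (p_gt0 : 0 < p) (p_lt1 : p < 1)
    (k : nat) (kE : k%:Z = Num.ceil (1 / (1 - p)))
    (g_trunc : {ae gamma, forall y, cube y ->
       `|g y - g (truncate s y)| @[s --> \oo] --> (0 : R)})
    (Theta : nat -> R) (Theta_ge0 : forall m, 0 <= Theta m)
    (b : nat -> R) (b_ge0 : forall j, 0 <= b j) (b_dec : nonincreasing_seq b)
    (b_lp : (\sum_(0 <= j <oo) (`|b j| `^ p)%:E < +oo)%E)
    (g_diff : continuously_differentiable k.+1 g)
    (g_bound : forall (y : nat -> R) (nu : multi_index),
       cube y -> (multi_order nu <= k.+1)%N ->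
       `|mixed_partial nu g y| <= Theta (multi_order nu) * multi_power b nu) :
  exists C : R, [/\ 0 < C,
    forall s : nat, (0 < s)%N ->
      bochner_integrable gamma cube (fun y => g y - g (truncate s y)) /\
      `|bochner_integral gamma cube (fun y => g y - g (truncate s y))|
        <= C * s%:R `^ (- (2 / p) + 1) &
    forall (G : {linear X -> R^o}), continuous G ->
      forall s : nat, (0 < s)%N ->
      (`|\int[gamma]_(y in cube) (G (g y - g (truncate s y)))%:E|
        <= (C * dual_norm G * s%:R `^ (- (2 / p) + 1))%:E)%E].
Proof.
(* So the hypotheses reach derivatives of order 2. *)
have k_gt0 : (0 < k)%N.
  by rewrite -ltz_nat kE ceil_gt0 divr_gt0// subr_gt0.
pose L j := Theta 1 * b j; pose K j := Theta 2 * b j ^+ 2.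
have L_ge0 j : 0 <= L j by rewrite mulr_ge0.
have [g1 _] := g_diff.
have hp j y : cube y -> has_partial j g y by exact: (g1 [::]).
have hp2 j y : cube y -> has_partial j (partial j g) y.
  by apply: (g1 [:: j]); rewrite ltnS.
have gL j y : cube y -> `|partial j g y| <= L j.
  move=> yc; have := @g_bound y (single_index j 1) yc.
  rewrite multi_order_single// multi_power_single// mixed_partial_single//.
  exact.
have gK j y : cube y -> `|partial j (partial j g) y| <= K j.
  move=> yc; have := @g_bound y (single_index j 2) yc.
  rewrite multi_order_single// multi_power_single// mixed_partial_single//.
  exact.
pose S := fine (\sum_(0 <= j <oo) (`|b j| `^ p)%:E)%E.
have bS n : \sum_(0 <= j < n) b j `^ p <= S.
  rewrite -lee_fin fineK; last first.
    by rewrite ge0_fin_numE// nneseries_ge0// => j _ _;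
      rewrite lee_fin powR_ge0.
  apply: (@le_trans _ _ (\sum_(0 <= j < n) (`|b j| `^ p)%:E)%E); last first.
    by apply: nneseries_lim_ge => j _ _; rewrite lee_fin powR_ge0.
  by rewrite sumEFin lee_fin; apply: ler_sum => j _; rewrite ger0_norm.
have L_cvg : cvgn (series L).
  apply: nondecreasing_is_cvgn.
    by apply/nondecreasing_seqP => m; rewrite seriesSr lerDl.
  exists (Theta 1 * (S * b 0 `^ (1 - p))) => _ [n _ <-].
  rewrite /series/= -mulr_sumr ler_wpM2l//.
  exact: (lp_sum_bound p_gt0 p_lt1 b_ge0 b_dec bS).
(* The summand 1 makes [C] positive when [Theta 2] or [S] vanishes. *)
pose C := Theta 2 * (S * S `^ (2 / p - 1)) + 1.
have S_ge0 : 0 <= S by have := bS 0; rewrite big_nil.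
have C_gt0 : 0 < C by rewrite ltr_wpDl// !mulr_ge0// powR_ge0.
pose B s := C * s%:R `^ (- (2 / p) + 1).
pose f s y := g y - g (truncate s y).
pose phi s n := f s \o (@grid_seq R n n \o @grid_cell_of R n n).
have phiB s n : (0 < s)%N ->
    bochner_simple (cube : set (g_sigma_algebraType (coordinate_sets R)))
      (phi s n) /\
    `|simple_integral gamma cube (phi s n)| <= B s.
  move=> s0; apply: norm_grid_simple_integral => //.
  rewrite (le_trans (grid_sum_truncation hp hp2 gK n n s))// ler_wpM2r//.
  rewrite -mulr_sumr /B /C mulrDl mul1r -mulrA.
  apply: (@le_trans _ _ (Theta 2 *
      (S * S `^ (2 / p - 1) * s%:R `^ (- (2 / p) + 1)))).
    by rewrite ler_wpM2l// (lp_square_tail p_gt0 p_lt1 b_ge0 b_dec bS).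
  by rewrite lerDl powR_ge0.
(* [f s] is a difference of two values of [g], each of which is rounded. *)
pose eps n := rounding_error L n *+ 2.
have eps_ge0 n : 0 <= eps n by rewrite mulrn_wge0// rounding_error_ge0.
have eps_cvg : eps @ \oo --> (0 : R).
  rewrite -(mul0rn _ 2); apply: cvgMn; exact: rounding_error_cvg0.
have f_phi s : {ae gamma, forall y, cube y ->
    forall n, `|f s y - phi s n y| <= eps n}.
  have aeF : Filter (almost_everywhere gamma) := ae_filter_ringOfSetsType gamma.
  apply: filterS g_trunc => y gy yc n.
  pose z := grid_seq R (grid_cell_of n n y).
  have yz : `|g y - g z| <= rounding_error L n.
    exact: (grid_rounding_dist L_ge0 L_cvg hp gL) (gy yc).
  have tyz : `|g (truncate s y) - g (truncate s z)| <= rounding_error L n.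
    apply: (truncate_rounding_dist L_ge0 L_cvg hp gL) => //.
      exact: grid_seq_cube.
    exact: close_to_order_grid.
  have -> : f s y - phi s n y =
      (g y - g z) - (g (truncate s y) - g (truncate s z)).
    by rewrite /phi /f/= -/z !opprD addrACA.
  by rewrite (le_trans (ler_normB _ _))// /eps mulr2n lerD.
have mcube := @measurable_cube R.
exists C; split => // [s s0|G Gcont s s0].
  have sphi n := (phiB s n s0).1; have phi_le n := (phiB s n s0).2.
  split; first by exists (phi s);
    exact: (almost_uniform_bochner_approx mcube eps_cvg eps_ge0 sphi (f_phi s)).
  exact: (norm_bochner_integral_le mcube eps_cvg eps_ge0 sphi (f_phi s)).
have sphi n := (phiB s n s0).1; have phi_le n := (phiB s n s0).2.
rewrite (mulrC C) -mulrA.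
exact: (abs_integral_functional_le mcube eps_cvg eps_ge0 sphi (f_phi s)).
Qed.
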